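(* Let $m\ge n\ge 1$ and let $\mathfrak n\subseteq\mathfrak{gl}(m|n)$ be the nilpotent subalgebra described in the context. (a) If $m>n$, then $\operatorname{H}^1(\mathfrak n,\mathbb C)$ has dimension $m+3n-3$. It is a direct sum of one-dimensional weight spaces; the weights of its even part are $\epsilon_{i+1}-\epsilon_i$ ($1\le i\le m-1$) and $\delta_{j+1}-\delta_j$ ($1\le j\le n-1$), and the weights of its odd part are $\delta_{i+1}-\epsilon_i$ ($1\le i\le n-1$) and $\epsilon_{j+1}-\delta_j$ ($1\le j\le n$). (b) If $m=n$, then $\operatorname{H}^1(\mathfrak n,\mathbb C)$ has dimension $4(n-1)$. It is a direct sum of one-dimensional weight spaces; the weights of its even part are $\epsilon_{i+1}-\epsilon_i$ and $\delta_{i+1}-\delta_i$ ($1\le i\le n-1$), and the weights of its odd part are $\delta_{i+1}-\epsilon_i$ and $\epsilon_{i+1}-\delta_i$ ($1\le i\le n-1$).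
   Context: All spaces are over $\mathbb C$. Rows and columns of matrices in $\mathfrak{gl}(m|n)$ are indexed by $\bar1,\dots,\bar m$ (even) and $1,\dots,n$ (odd); $E_{ab}$ are the elementary matrices, with supercommutator bracket $[E_{ab},E_{cd}]=\delta_{bc}E_{ad}-(-1)^{|E_{ab}||E_{cd}|}\delta_{da}E_{cb}$. The subalgebra $\mathfrak n$ is spanned by $E_{\bar i,\bar j}$ ($1\le i<j\le m$), $E_{i,j}$ ($1\le i<j\le n$), $E_{\bar i,j}$ ($1\le i\le m$, $1\le j\le n$, $i<j$), and $E_{i,\bar j}$ ($1\le i\le n$, $1\le j\le m$, $i<j$). Weights are taken with respect to the diagonal matrices of $\mathfrak{gl}(m|n)$ acting through the adjoint action on $\mathfrak n$: $\epsilon_i$ is the functional giving the $\bar i$-th diagonal entry and $\delta_j$ the one giving the $j$-th (odd-index) diagonal entry, so e.g. $E_{\bar i,\bar j}$ has weight $\epsilon_i-\epsilon_j$, and its dual vector has weight $\epsilon_j-\epsilon_i$. $\operatorname{H}^\bullet(\mathfrak n,\mathbb C)$ is the Lie superalgebra cohomology with trivial (even, one-dimensional) coefficients, i.e. the cohomology of the complex $C^p=\operatorname{Hom}(\Lambda_s^p(\mathfrak n),\mathbb C)$ with $\Lambda_s^p(\mathfrak n)=\bigoplus_{i+j=p}\Lambda^i(\mathfrak n_{\bar0})\otimes S^j(\mathfrak n_{\bar1})$ and differential $$df(\omega_0\wedge\cdots\wedge\omega_p)=\sum_{i<j}(-1)^{\sigma_{i,j}}f([\omega_i,\omega_j]\wedge\omega_0\wedge\cdots\widehat{\omega_i}\cdots\widehat{\omega_j}\cdots\wedge\omega_p),$$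 $\sigma_{i,j}=i+j+|\omega_i||\omega_j|+|\omega_i|(|\omega_0|+\cdots+|\omega_{i-1}|)+|\omega_j|(|\omega_0|+\cdots+|\omega_{j-1}|)$. It carries the induced $\mathbb Z_2$-grading. *)

(* Defs.v *)
From HB Require Import structures.
From mathcomp Require Import all_boot all_order all_algebra.
From mathcomp Require Import boolp classical_sets reals complex ring.

Set Implicit Arguments.
Unset Strict Implicit.
Unset Printing Implicit Defensive.

Import Order.TTheory GRing.Theory Num.Theory.
Local Open Scope ring_scope.

Lemma linfunE (F : fieldType) (V W : vectType F) (f : V -> W) :
  (forall a x y, f (a *: x + y) = a *: f x + f y) -> linfun f =1 f.
Proof.
move=> lin x.
pose lf : {linear V -> W} := HB.pack f (GRing.isLinear.Build _ _ _ _ f lin).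
exact: (lfunE lf).
Qed.

Section LinearAlgebra.
Variables (F : fieldType) (V : vectType F).

(* The subspace cut out by a predicate P (meaningful when P is closed under
   linear combinations, see vspace_ofP). *)
Definition vspace_of (P : V -> Prop) : {vspace V} :=
  xget 0%VS [set U : {vspace V} | forall v, v \in U <-> P v].

Lemma vspace_ofP (P : V -> Prop) :
  P 0 -> (forall a u v, P u -> P v -> P (a *: u + v)) ->
  forall v, v \in vspace_of P <-> P v.
Proof.
move=> P0 PD.
suff [U PU] : exists U : {vspace V}, forall v, v \in U <-> P v.
  by rewrite /vspace_of; case: xgetP => [W _ //|/(_ U)].
have step k : (exists U : {vspace V}, forall v, v \in U <-> P v) \/
    exists2 U : {vspace V}, (forall v, v \in U -> P v) & (k <= \dim U)%N.
  elim: k => [|k [IH|[U UP dU]]]; first 2 [by left].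
    by right; exists 0%VS => // v; rewrite memv0 => /eqP ->.
  have [PU|/existsNP[v /not_implyP[Pv /negP vU]]] :=
    pselect (forall v, P v -> v \in U).
    by left; exists U => v; split=> [/UP|/PU].
  right; exists (U + <[v]>)%VS.
    move=> _ /memv_addP[u uU [_ /vlineP[a ->] ->]].
    by rewrite addrC; apply: PD => //; apply: UP.
  apply: leq_ltn_trans dU _.
  rewrite (ltn_leqif (dimv_leqif_sup (addvSl U <[v]>))).
  by rewrite subv_add subvv -memvE.
have [//|[U _]] := step (\dim {:V}).+1.
by rewrite ltnNge dimvS ?subvf.
Qed.

Variable W : {vspace V}.

(* The quotient V / W, carried by a complement of W; quo is the projection. *)
Definition quotv : vectType F := subvs_of (W^C)%VS.

Definition quo : 'Hom(V, quotv) :=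
  linfun (fun v => vsproj (W^C)%VS (daddv_pi (W^C)%VS W v)).

Lemma quoE v : vsval (quo v) = daddv_pi (W^C)%VS W v.
Proof. by rewrite (lfunE (vsproj _ \o daddv_pi _ _)) /= vsprojK ?memv_pi. Qed.

Lemma lker_quo : lker quo = W.
Proof.
have dWC : (W^C :&: W = 0)%VS by rewrite capvC capv_compl.
have dW : (W :&: W^C = 0)%VS by rewrite capv_compl.
have sumW v : daddv_pi (W^C)%VS W v + daddv_pi W (W^C)%VS v = v.
  by apply: daddv_pi_add; rewrite // addvC addv_complf memvf.
apply/vspaceP=> v; rewrite memv_ker -(inj_eq (@subvs_inj _ _ _)) quoE linear0.
apply/eqP/idP => [v0|vW].
  by rewrite -(sumW v) v0 add0r memv_pi.
by apply: (addIr (daddv_pi W (W^C)%VS v)); rewrite sumW add0r daddv_pi_id.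
Qed.

Lemma limg_quo : limg quo = fullv.
Proof.
apply/vspaceP=> x; rewrite memvf; apply/memv_imgP; exists (vsval x).
  exact: memvf.
apply: subvs_inj; rewrite quoE daddv_pi_id ?subvsP //.
by rewrite capvC capv_compl.
Qed.

End LinearAlgebra.

Section MultilinearForms.
Variables (F : fieldType) (L : vectType F).

Fixpoint mform (p : nat) : vectType F :=
  if p is q.+1 then 'Hom(L, mform q) else F^o.

(* f(w_1, ..., w_p), for w of size p *)
Fixpoint meval (p : nat) : mform p -> seq L -> F :=
  match p return mform p -> seq L -> F with
  | 0 => fun f _ => f
  | q.+1 => fun f w => meval (f (head 0 w)) (behead w)
  end.

(* The p-linear form (w_1, ..., w_p) |-> g w, when g is p-linear *)
Fixpoint mk_form (p : nat) : (seq L -> F) -> mform p :=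
  match p return (seq L -> F) -> mform p with
  | 0 => fun g => g [::]
  | q.+1 => fun g => linfun (fun x => mk_form q (fun w => g (x :: w)))
  end.

Definition multilinear (p : nat) (g : seq L -> F) : Prop :=
  forall w1 w2 a x y, (size w1 + size w2).+1 = p ->
  g (w1 ++ (a *: x + y) :: w2) = a * g (w1 ++ x :: w2) + g (w1 ++ y :: w2).

Lemma meval_linear p w a f g :
  meval (a *: f + g : mform p) w = a * meval f w + meval g w.
Proof.
elim: p f g w => [//|p IH] f g w /=.
by rewrite add_lfunE scale_lfunE IH.
Qed.

Lemma meval_multilinear p (f : mform p) : multilinear p (meval f).
Proof.
elim: p f => [|p IH] f [|z w1] w2 a x y //= [sz].
  by rewrite linearP meval_linear.
exact: IH.
Qed.

Lemma mform_eqP p (f g : mform p) :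
  (forall w, size w = p -> meval f w = meval g w) -> f = g.
Proof.
elim: p f g => [|p IH] f g fg; first exact: (fg [::]).
apply/lfunP=> x; apply: IH => w sw.
by apply: (fg (x :: w)); rewrite /= sw.
Qed.

Lemma meval_mk_form p g w : multilinear p g -> size w = p ->
  meval (mk_form p g) w = g w.
Proof.
elim: p g w => [|p IH] g [|x w] //= lin_g [sw].
have lin_gx y : multilinear p (fun w => g (y :: w)).
  by move=> w1 w2 a u v sz; apply: (lin_g (y :: w1)); rewrite /= -sz.
have lin a u v : mk_form p (fun w => g ((a *: u + v) :: w)) =
    a *: mk_form p (fun w => g (u :: w)) + mk_form p (fun w => g (v :: w)).
  apply: mform_eqP => z sz.
  rewrite meval_linear !IH //.
  by apply: (lin_g [::]); rewrite /= sz.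
by rewrite linfunE // IH.
Qed.

End MultilinearForms.

(* Lie superalgebras, with false = even and true = odd: gr b is the projection
   to the component of parity b. *)
Record lieSuper (F : numFieldType) := LieSuper {
  lie_sort :> vectType F;
  gr : bool -> 'End(lie_sort);
  br : lie_sort -> lie_sort -> lie_sort;
  grD : forall x, gr false x + gr true x = x;
  gr_gr : forall a b x, gr a (gr b x) = if a == b then gr b x else 0;
  br_linearr : forall x a y z, br x (a *: y + z) = a *: br x y + br x z;
  br_linearl : forall z a x y, br (a *: x + y) z = a *: br x z + br y z;
  gr_br : forall a b x y,
    gr (a (+) b) (br (gr a x) (gr b y)) = br (gr a x) (gr b y);
  br_anti : forall a b x y,
    br (gr a x) (gr b y) = - ((-1) ^+ (a && b) *: br (gr b y) (gr a x));
  br_jacobi : forall a b x y z,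
    br (gr a x) (br (gr b y) z) =
      br (br (gr a x) (gr b y)) z
      + (-1) ^+ (a && b) *: br (gr b y) (br (gr a x) z)
}.

Arguments gr {F l} b.
Arguments br {F l} x y.

Section SubSuperalgebra.
Variables (F : numFieldType) (G : lieSuper F) (U : {vspace G}).
Hypothesis U_gr : forall b x, x \in U -> gr b x \in U.
Hypothesis U_br : forall x y, x \in U -> y \in U -> br x y \in U.

Definition sub_gr (b : bool) : 'End(subvs_of U) :=
  linfun (fun x => vsproj U (gr b (vsval x))).
Definition sub_br (x y : subvs_of U) : subvs_of U :=
  vsproj U (br (vsval x) (vsval y)).

Lemma val_sub_gr b x : vsval (sub_gr b x) = gr b (vsval x).
Proof.
by rewrite (lfunE (vsproj U \o (gr b \o vsval))) /= vsprojK ?U_gr ?subvsP.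
Qed.

Lemma val_sub_br x y : vsval (sub_br x y) = br (vsval x) (vsval y).
Proof. by rewrite vsprojK ?U_br ?subvsP. Qed.

Lemma sub_grD x : sub_gr false x + sub_gr true x = x.
Proof. by apply: subvs_inj; rewrite linearD /= !val_sub_gr grD. Qed.

Lemma sub_gr_gr a b x :
  sub_gr a (sub_gr b x) = if a == b then sub_gr b x else 0.
Proof.
apply: subvs_inj; rewrite !val_sub_gr gr_gr.
by case: eqP; rewrite ?val_sub_gr ?linear0.
Qed.

Lemma sub_br_linearr x a y z :
  sub_br x (a *: y + z) = a *: sub_br x y + sub_br x z.
Proof.
by apply: subvs_inj; rewrite linearP /= !val_sub_br linearP br_linearr.
Qed.

Lemma sub_br_linearl z a x y :
  sub_br (a *: x + y) z = a *: sub_br x z + sub_br y z.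
Proof.
by apply: subvs_inj; rewrite linearP /= !val_sub_br linearP br_linearl.
Qed.

Lemma sub_gr_br a b x y :
  sub_gr (a (+) b) (sub_br (sub_gr a x) (sub_gr b y)) =
  sub_br (sub_gr a x) (sub_gr b y).
Proof.
by apply: subvs_inj; rewrite val_sub_gr val_sub_br !val_sub_gr gr_br.
Qed.

Lemma sub_br_anti a b x y : sub_br (sub_gr a x) (sub_gr b y) =
  - ((-1) ^+ (a && b) *: sub_br (sub_gr b y) (sub_gr a x)).
Proof.
apply: subvs_inj.
by rewrite linearN linearZ /= !val_sub_br !val_sub_gr br_anti ?scalerN.
Qed.

Lemma sub_br_jacobi a b x y z :
  sub_br (sub_gr a x) (sub_br (sub_gr b y) z) =
    sub_br (sub_br (sub_gr a x) (sub_gr b y)) z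
    + (-1) ^+ (a && b) *: sub_br (sub_gr b y) (sub_br (sub_gr a x) z).
Proof.
apply: subvs_inj.
by rewrite linearD linearZ /= !val_sub_br !val_sub_gr br_jacobi.
Qed.

Definition sub_lieSuper : lieSuper F :=
  @LieSuper F (subvs_of U) sub_gr sub_br sub_grD sub_gr_gr sub_br_linearr
    sub_br_linearl sub_gr_br sub_br_anti sub_br_jacobi.

End SubSuperalgebra.

Section Cohomology.
Variables (F : numFieldType) (G : lieSuper F).

Definition homogeneous (e : seq bool) (w : seq G) : Prop :=
  [seq gr x.1 x.2 | x <- zip e w] = w /\ size e = size w.

(* Hom(Lambda_s^p(G), F): the p-linear forms vanishing on the relations
   x /\ y = - (-1)^(|x||y|) y /\ x of the super-exterior algebra. *)
Definition cochains (p : nat) : {vspace mform G p} :=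
  vspace_of (fun f => forall w1 w2 a b x y,
    (size w1 + size w2).+2 = p ->
    meval f (w1 ++ gr a x :: gr b y :: w2) =
      - ((-1) ^+ (a && b) * meval f (w1 ++ gr b y :: gr a x :: w2))).

Lemma cochainsP p (f : mform G p) : f \in cochains p <->
  forall w1 w2 a b x y, (size w1 + size w2).+2 = p ->
    meval f (w1 ++ gr a x :: gr b y :: w2) =
      - ((-1) ^+ (a && b) * meval f (w1 ++ gr b y :: gr a x :: w2)).
Proof.
pose P (f : mform G p) := forall w1 w2 a b x y, (size w1 + size w2).+2 = p ->
    meval f (w1 ++ gr a x :: gr b y :: w2) =
      - ((-1) ^+ (a && b) * meval f (w1 ++ gr b y :: gr a x :: w2)).
apply: (@vspace_ofP _ _ P) => [|c u v Pu Pv] w1 w2 a b x y sz.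
  have meval0 w : meval (0 : mform G p) w = 0.
    have := meval_linear w (-1) (0 : mform G p) 0.
    by rewrite scaleN1r addNr mulN1r addNr.
  by rewrite !meval0 mulr0 oppr0.
by rewrite !meval_linear Pu // Pv // mulrN -opprD mulrDr mulrCA.
Qed.

(* F is even: a form of parity b vanishes on homogeneous arguments whose total
   parity is not b. *)
Definition cochains_of_parity (p : nat) (b : bool) : {vspace mform G p} :=
  vspace_of (fun f => f \in cochains p /\ forall e w,
    size w = p -> homogeneous e w -> odd (count id e) != b -> meval f w = 0).

Lemma cochains_of_parityP p b (f : mform G p) :
  f \in cochains_of_parity p b <-> f \in cochains p /\ forall e w,
    size w = p -> homogeneous e w -> odd (count id e) != b -> meval f w = 0.
Proof.
pose P (f : mform G p) := f \in cochains p /\ forall e w,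
    size w = p -> homogeneous e w -> odd (count id e) != b -> meval f w = 0.
apply: (@vspace_ofP _ _ P) => [|c u v [Cu Pu] [Cv Pv]]; split.
- exact: mem0v.
- move=> e w _ _ _; have := meval_linear w (-1) (0 : mform G p) 0.
  by rewrite scaleN1r addNr mulN1r addNr.
- by rewrite memvD ?memvZ.
- move=> e w sw ew eb; rewrite meval_linear (Pu e w sw ew eb).
  by rewrite (Pv e w sw ew eb) mulr0 addr0.
Qed.

Definition ce_sigma (e : seq bool) (i j : nat) : nat :=
  let par k : nat := nth false e k in
  i + j + par i * par j
  + par i * (\sum_(k < i) par k) + par j * (\sum_(k < j) par k).

Definition ce_term p (f : mform G p) (e : seq bool) (w : seq G) (i j : nat) :=
  (-1) ^+ ce_sigma e i j *
  meval f (br w`_i w`_j ::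
           [seq w`_k | k <- iota 0 (size w) & (k != i) && (k != j)]).

Lemma ce_term_multilinear p (f : mform G p) e i j : (i < j <= p)%N ->
  multilinear p.+1 (fun w => ce_term f e w i j).
Proof.
move=> /andP[ij jp] w1 w2 a x y [sz]; rewrite /ce_term.
pose q := size w1; pose W z := w1 ++ z :: w2; rewrite -!/(W _).
have Wq z : (W z)`_q = z by rewrite nth_cat ltnn subnn.
have W0 z k : k != q -> (W z)`_k = (W 0)`_k.
  rewrite !nth_cat -/q; case: ltngtP => // qk _.
  by rewrite -(subnSK qk).
have szW z : size (W z) = (q + (size w2).+1)%N by rewrite size_cat.
pose P k := (k != i) && (k != j).
pose A := [seq (W 0)`_k | k <- iota 0 q & P k].
pose B := [seq (W 0)`_k | k <- iota q.+1 (size w2) & P k].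
have argsE z : [seq (W z)`_k | k <- iota 0 (size (W z)) & P k] =
    A ++ (if P q then z :: B else B).
  rewrite szW iotaD filter_cat map_cat /= add0n; congr (_ ++ _).
    apply/eq_in_map=> k; rewrite mem_filter mem_iota => /and3P[_ _ kq].
    by apply: W0; rewrite ltn_eqF.
  have BE : [seq (W z)`_k | k <- iota q.+1 (size w2) & P k] = B.
    apply/eq_in_map=> k; rewrite mem_filter mem_iota => /and3P[_ qk _].
    by apply: W0; rewrite gtn_eqF.
  by case: (P q); rewrite ?map_cons ?Wq BE.
have size_args z :
    size (br (W z)`_i (W z)`_j :: A ++ (if P q then z :: B else B)) = p.
  have iW : (i < q + (size w2).+1)%N.
    by rewrite addnS sz ltnS (leq_trans (ltnW ij) jp).
  have jW : (j < q + (size w2).+1)%N by rewrite addnS sz ltnS.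
  rewrite /= -argsE size_map size_filter szW.
  have := count_predC P (iota 0 (q + (size w2).+1)).
  rewrite size_iota addnS sz.
  have -> : count (predC P) (iota 0 p.+1) = 2.
    rewrite (@eq_count _ _ (predU (pred1 i) (pred1 j))); last first.
      by move=> k; rewrite /= negb_and !negbK.
    have := count_predUI (pred1 i) (pred1 j) (iota 0 p.+1).
    rewrite (@eq_count _ (predI _ _) pred0) ?count_pred0 ?addn0; last first.
      by move=> k /=; apply/negbTE/andP=> -[/eqP ->]; rewrite ltn_eqF.
    move=> ->; rewrite !count_uniq_mem ?iota_uniq // !mem_iota /= !add0n.
    by rewrite !ltnS jp (leq_trans (ltnW ij) jp).
  by rewrite addn2 => -[].
rewrite !argsE [a * _]mulrCA -mulrDr; congr (_ * _).
have := size_args 0; case: ifP => [/andP[qi qj]|Pq] /=.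
  have Wi z : (W z)`_i = (W 0)`_i by rewrite W0 // eq_sym.
  have Wj z : (W z)`_j = (W 0)`_j by rewrite W0 // eq_sym.
  rewrite !(Wi (_ + _), Wi x, Wi y, Wj (_ + _), Wj x, Wj y).
  rewrite size_cat /= => szp.
  by apply: (@meval_multilinear _ _ _ f (_ :: A))=> /=; rewrite -szp addnS.
rewrite size_cat => szp.
suff -> : br (W (a *: x + y))`_i (W (a *: x + y))`_j =
    a *: br (W x)`_i (W x)`_j + br (W y)`_i (W y)`_j.
  by apply: (@meval_multilinear _ _ _ f [::]); rewrite /= size_cat.
move: Pq; rewrite /P; case: (eqVneq q i) => [qi _|_ /negbFE/eqP qj].
  have Wj z : (W z)`_j = (W 0)`_j by rewrite W0 // qi gtn_eqF.
  by rewrite -qi !Wq (Wj (_ + _)) (Wj x) (Wj y) br_linearl.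
have Wi z : (W z)`_i = (W 0)`_i by rewrite W0 // qj ltn_eqF.
by rewrite -qj !Wq (Wi (_ + _)) (Wi x) (Wi y) br_linearr.
Qed.

Lemma multilinear0 (L : vectType F) p (g : seq L -> F) w q :
  multilinear p g -> size w = p -> (q < p)%N -> w`_q = 0 -> g w = 0.
Proof.
move=> lin_g sw qp wq; rewrite -(cat_take_drop q w) (drop_nth 0) ?sw // wq.
have := lin_g (take q w) (drop q.+1 w) (-1) 0 0.
rewrite scaleN1r oppr0 addr0 mulN1r addNr; apply.
by rewrite size_take size_drop sw qp -addnS subnSK // subnKC // ltnW.
Qed.

(* The formula for d makes sense on homogeneous arguments (see
   meval_ce_diff); arbitrary arguments are expanded into their homogeneous
   components. *)
Definition ce_diff_fun p (f : mform G p) (w : seq G) : F :=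
  \sum_(e : p.+1.-tuple bool) \sum_(j < p.+1) \sum_(i < j)
    ce_term f e [seq gr x.1 x.2 | x <- zip e w] i j.

Definition ce_diff (p : nat) : 'Hom(mform G p, mform G p.+1) :=
  linfun (fun f => mk_form p.+1 (ce_diff_fun f)).

Lemma ce_diff_fun_multilinear p (f : mform G p) :
  multilinear p.+1 (ce_diff_fun f).
Proof.
move=> w1 w2 a x y sz; rewrite /ce_diff_fun mulr_sumr -big_split /=.
apply: eq_bigr => e _; rewrite mulr_sumr -big_split /=.
apply: eq_bigr => j _; rewrite mulr_sumr -big_split /=.
apply: eq_bigr => i _.
have comps z : [seq gr b.1 b.2 | b <- zip e (w1 ++ z :: w2)] =
    [seq gr b.1 b.2 | b <- zip (take (size w1) e) w1] ++
    gr (nth false e (size w1)) z ::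
    [seq gr b.1 b.2 | b <- zip (drop (size w1).+1 e) w2].
  have se : (size w1 < size e)%N by rewrite size_tuple -sz ltnS leq_addr.
  rewrite -[in LHS](cat_take_drop (size w1) e) zip_cat ?size_takel //;
    last first.
    exact: ltnW.
  by rewrite map_cat (drop_nth false).
rewrite !comps linearP.
apply: (@ce_term_multilinear p f e i j).
  by rewrite ltn_ord -ltnS ltn_ord.
have se : size e = (size w1 + size w2).+1 by rewrite size_tuple.
rewrite !size_map !size_zip size_drop size_takel se ?subSS ?addKn ?minnn //.
by rewrite -addnS leq_addr.
Qed.

(* The formula for the differential on homogeneous arguments. *)
Lemma meval_ce_diff p (f : mform G p) e w : size w = p.+1 ->
  homogeneous e w ->
  meval (ce_diff p f) w = \sum_(j < p.+1) \sum_(i < j) ce_term f e w i j.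
Proof.
move=> sw [we se].
rewrite linfunE => [|a u v]; last first.
  apply: mform_eqP => z sz.
  rewrite meval_linear !meval_mk_form //; try exact: ce_diff_fun_multilinear.
  rewrite /ce_diff_fun mulr_sumr -big_split /=.
  apply: eq_bigr => e' _; rewrite mulr_sumr -big_split /=.
  apply: eq_bigr => j _; rewrite mulr_sumr -big_split /=.
  apply: eq_bigr => i _.
  by rewrite /ce_term meval_linear mulrDr mulrCA.
rewrite meval_mk_form //; last exact: ce_diff_fun_multilinear.
have /eqP sep : size e = p.+1 by rewrite se.
rewrite /ce_diff_fun (bigD1 (Tuple sep)) //= we.
rewrite [X in _ + X]big1 ?addr0 // => e' ne.
have [q qp neq] : exists2 q, (q < p.+1)%N & nth false e' q != nth false e q.
  apply: contrapT => eqe; move/eqP: ne; apply; apply: val_inj => /=.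
  apply: (@eq_from_nth _ false); rewrite size_tuple ?(eqP sep) // => q qp.
  by apply/eqP/negPn/negP=> neq; apply: eqe; exists q.
have wq : [seq gr x.1 x.2 | x <- zip e' w]`_q = 0.
  rewrite (nth_map (false, 0)); last by rewrite size_zip size_tuple sw minnn.
  rewrite nth_zip ?size_tuple ?sw //= -we (nth_map (false, 0)); last first.
    by rewrite size_zip (eqP sep) sw minnn.
  by rewrite nth_zip ?(eqP sep) ?sw //= gr_gr (negbTE neq).
rewrite big1 // => j _; rewrite big1 // => i _.
have lin : multilinear p.+1 (fun w => ce_term f e' w i j).
  by apply: ce_term_multilinear; rewrite ltn_ord -ltnS ltn_ord.
by apply: (multilinear0 lin) wq => //;
  rewrite size_map size_zip size_tuple sw minnn.
Qed.

Definition cocycles (p : nat) : {vspace mform G p} :=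
  (cochains p :&: lker (ce_diff p))%VS.

Definition coboundaries (p : nat) : {vspace mform G p} :=
  match p with
  | 0 => 0%VS
  | q.+1 => (ce_diff q @: cochains q)%VS
  end.

Definition cohomology (p : nat) : {vspace quotv (coboundaries p)} :=
  (quo (coboundaries p) @: cocycles p)%VS.

Definition cohomology_of_parity (p : nat) (b : bool) :
    {vspace quotv (coboundaries p)} :=
  (quo (coboundaries p) @: (cochains_of_parity p b :&: cocycles p))%VS.

(* The action on p-forms of an even derivation D of G. *)
Definition form_act (D : 'End(G)) (p : nat) (f : mform G p) : mform G p :=
  mk_form p (fun w => - \sum_(i < p) meval f (set_nth 0 w i (D w`_i))).

Lemma form_act_fun_multilinear (D : 'End(G)) p (f : mform G p) :
  multilinear p (fun w => - \sum_(i < p) meval f (set_nth 0 w i (D w`_i))).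
Proof.
move=> w1 w2 a x y sz; rewrite mulrN -opprD mulr_sumr -big_split /=.
congr (- _); apply: eq_bigr => i _.
have [iw|iw|iw] := ltngtP i (size w1).
- have E z t : set_nth 0 (w1 ++ z :: w2) i t = set_nth 0 w1 i t ++ z :: w2.
    by elim: w1 (i : nat) iw {sz} => [|u w1 IH] [|k] //= /IH ->.
  rewrite !nth_cat iw !E; apply: meval_multilinear.
  by rewrite size_set_nth (maxn_idPr iw).
- have E z t : set_nth 0 (w1 ++ z :: w2) i t =
      w1 ++ z :: set_nth 0 w2 (i - (size w1).+1) t.
    rewrite -{1}(subnKC iw).
    by elim: w1 {iw sz} (_ - _)%N => [|u w1 IH] k //=; rewrite IH.
  have N z : (w1 ++ z :: w2)`_i = w2`_(i - (size w1).+1).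
    by rewrite nth_cat ltnNge (ltnW iw) /= -(subnSK iw).
  rewrite !N !E; apply: meval_multilinear; rewrite size_set_nth.
  rewrite (maxn_idPr _) // -(ltn_add2l (size w1)) -ltnS -addSn subnKC //.
  by rewrite sz ltn_ord.
- have E z t : set_nth 0 (w1 ++ z :: w2) i t = w1 ++ t :: w2.
    by rewrite iw; elim: w1 {iw sz} => [|u w1 IH] //=; rewrite IH.
  have N z : (w1 ++ z :: w2)`_i = z by rewrite iw nth_cat ltnn subnn.
  by rewrite !E !N linearP; apply: meval_multilinear.
Qed.

Lemma form_actP D p (f : mform G p) w : size w = p ->
  meval (form_act D f) w = - \sum_(i < p) meval f (set_nth 0 w i (D w`_i)).
Proof. exact/meval_mk_form/form_act_fun_multilinear. Qed.

Lemma form_act_linear D p a (f g : mform G p) :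
  form_act D (a *: f + g) = a *: form_act D f + form_act D g.
Proof.
apply: mform_eqP => w sw; rewrite meval_linear !form_actP // mulrN -opprD.
rewrite mulr_sumr -big_split /=; congr (- _).
by apply: eq_bigr => i _; rewrite meval_linear.
Qed.

Variables (T : vectType F) (D : T -> 'End(G)).

(* Classes c = [f] of cocycles f such that h.[f] = [h.f] = mu(h) c for all h
   in T, where h acts through D h. *)
Definition cohomology_weight (p : nat) (mu : 'Hom(T, F^o)) :
    {vspace quotv (coboundaries p)} :=
  vspace_of (fun c => exists f, [/\ f \in cocycles p,
    c = quo (coboundaries p) f
    & forall h, quo (coboundaries p) (form_act (D h) f) = mu h *: c]).

Lemma cohomology_weightP p mu c : c \in cohomology_weight p mu <->
  exists f, [/\ f \in cocycles p, c = quo (coboundaries p) f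
    & forall h, quo (coboundaries p) (form_act (D h) f) = mu h *: c].
Proof.
apply: (vspace_ofP (P := fun c => exists f, [/\ _, _ & _])) => [|a u v].
  exists 0; split; rewrite ?linear0 ?mem0v // => h; rewrite scaler0.
  by have := form_act_linear (D h) (-1) (0 : mform G p) 0;
     rewrite !scaleN1r !addNr => ->; rewrite linear0.
move=> [f [Zf -> Wf]] [g [Zg -> Wg]]; exists (a *: f + g).
split; rewrite ?linearP ?memvD ?memvZ // => h.
by rewrite form_act_linear linearP /= Wf Wg scalerDr !scalerA mulrC.
Qed.

End Cohomology.

Section GeneralLinear.
Variables (F : numFieldType) (m n : nat).
Implicit Types X Y Z : 'M[F]_(m + n).

(* Rows and columns are indexed by 'I_(m + n): lshift n i is the i-th even
   index, rshift m j the j-th odd one. *)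
Definition gl_gr_fun (b : bool) X : 'M[F]_(m + n) :=
  if b then block_mx 0 (ursubmx X) (dlsubmx X) 0
  else block_mx (ulsubmx X) 0 0 (drsubmx X).

Definition gl_gr (b : bool) : 'End('M[F]_(m + n)) := linfun (gl_gr_fun b).

(* [X, Y] = X Y - (-1)^(|X||Y|) Y X for homogeneous X and Y. *)
Definition gl_br X Y : 'M[F]_(m + n) :=
  \sum_(a : bool) \sum_(b : bool)
    (gl_gr a X *m gl_gr b Y
     - (-1) ^+ (a && b) *: (gl_gr b Y *m gl_gr a X)).

Definition idx_odd (k : 'I_(m + n)) : bool :=
  if split k is inl _ then false else true.

Lemma gl_grE b X i j :
  gl_gr b X i j = if idx_odd i (+) idx_odd j == b then X i j else 0.
Proof.
have funE Y : gl_gr_fun b Y i j =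
    if idx_odd i (+) idx_odd j == b then Y i j else 0.
  rewrite -[in X in if _ then X else _](submxK Y).
  rewrite /gl_gr_fun /idx_odd; case: b; rewrite !mxE;
  by case: splitP => k _; rewrite !mxE; case: splitP => l _; rewrite !mxE.
suff lin a x y : gl_gr_fun b (a *: x + y) = a *: gl_gr_fun b x + gl_gr_fun b y.
  by rewrite linfunE.
rewrite /gl_gr_fun; case: b {funE}; rewrite scale_block_mx add_block_mx;
  rewrite !scaler0 !addr0; congr block_mx; apply/matrixP=> k l; by rewrite !mxE.
Qed.

Lemma gl_grM a b X Y : gl_gr (a (+) b) (gl_gr a X *m gl_gr b Y) =
  gl_gr a X *m gl_gr b Y.
Proof.
apply/matrixP=> i j; rewrite gl_grE !mxE.
case: eqP => // ne; rewrite big1 // => k _; rewrite !gl_grE.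
case: eqP => [ea|]; last by rewrite mul0r.
case: eqP => [eb|]; last by rewrite mulr0.
case: ne; rewrite -ea -eb.
by case: (idx_odd i) (idx_odd j) (idx_odd k) => [] [] [].
Qed.

Lemma gl_gr_gr a b X : gl_gr a (gl_gr b X) = if a == b then gl_gr b X else 0.
Proof.
apply/matrixP=> i j; case: eqP => [->|ne]; rewrite !gl_grE ?mxE.
  by case: eqP.
by do 2!case: eqP => // ->.
Qed.

Lemma gl_grD X : gl_gr false X + gl_gr true X = X.
Proof.
apply/matrixP=> i j; rewrite mxE !gl_grE.
by case: (_ (+) _); rewrite /= ?addr0 ?add0r.
Qed.

Lemma gl_br_linearr X a Y Z : gl_br X (a *: Y + Z) = a *: gl_br X Y + gl_br X Z.
Proof.
rewrite /gl_br scaler_sumr -big_split; apply: eq_bigr => b _ /=.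
rewrite scaler_sumr -big_split; apply: eq_bigr => c _ /=.
rewrite linearP /= mulmxDr mulmxDl -scalemxAl -scalemxAr scalerBr.
rewrite scalerDr opprD addrACA; congr (_ - _ + _).
by rewrite !scalerA mulrC.
Qed.

Lemma gl_br_linearl Z a X Y : gl_br (a *: X + Y) Z = a *: gl_br X Z + gl_br Y Z.
Proof.
rewrite /gl_br scaler_sumr -big_split; apply: eq_bigr => b _ /=.
rewrite scaler_sumr -big_split; apply: eq_bigr => c _ /=.
rewrite linearP /= mulmxDr mulmxDl -scalemxAl -scalemxAr scalerBr.
rewrite scalerDr opprD addrACA; congr (_ - _ + _).
by rewrite !scalerA mulrC.
Qed.

Lemma gl_br_homog a b X Y : gl_br (gl_gr a X) (gl_gr b Y) =
  gl_gr a X *m gl_gr b Y - (-1) ^+ (a && b) *: (gl_gr b Y *m gl_gr a X).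
Proof.
rewrite /gl_br (bigD1 a) //= (bigD1 b) //= !gl_gr_gr !eqxx.
rewrite !big1 ?addr0 // => c /negbTE ne; [rewrite big1 // => d _|];
  by rewrite !gl_gr_gr ne !(mul0mx, mulmx0) scaler0 subr0.
Qed.

Lemma gl_br_anti a b X Y : gl_br (gl_gr a X) (gl_gr b Y) =
  - ((-1) ^+ (a && b) *: gl_br (gl_gr b Y) (gl_gr a X)).
Proof.
rewrite !gl_br_homog scalerBr opprB scalerA -signr_addb.
by rewrite andbC addbb scale1r.
Qed.

Lemma gl_gr_br a b X Y :
  gl_gr (a (+) b) (gl_br (gl_gr a X) (gl_gr b Y)) =
  gl_br (gl_gr a X) (gl_gr b Y).
Proof.
by rewrite gl_br_homog linearB linearZ /= gl_grM addbC gl_grM.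
Qed.

Lemma gl_br_jacobi a b X Y Z :
  gl_br (gl_gr a X) (gl_br (gl_gr b Y) Z) =
    gl_br (gl_br (gl_gr a X) (gl_gr b Y)) Z
    + (-1) ^+ (a && b) *: gl_br (gl_gr b Y) (gl_br (gl_gr a X) Z).
Proof.
have brD U V W : gl_br U (V + W) = gl_br U V + gl_br U W.
  by have := gl_br_linearr U 1 V W; rewrite !scale1r.
suff homog c : gl_br (gl_gr a X) (gl_br (gl_gr b Y) (gl_gr c Z)) =
    gl_br (gl_br (gl_gr a X) (gl_gr b Y)) (gl_gr c Z)
    + (-1) ^+ (a && b) *: gl_br (gl_gr b Y) (gl_br (gl_gr a X) (gl_gr c Z)).
  by rewrite -(gl_grD Z) !brD !homog scalerDr addrACA.
have brE d e U V : gl_gr d U = U -> gl_gr e V = V ->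
    gl_br U V = U *m V - (-1) ^+ (d && e) *: (V *m U).
  by move=> dU eV; have := gl_br_homog d e U V; rewrite dU eV.
have gr_id d U : gl_gr d (gl_gr d U) = gl_gr d U by rewrite gl_gr_gr eqxx.
rewrite (brE a (b (+) c) _ (gl_br _ _)) ?gr_id ?gl_gr_br //.
rewrite (brE (a (+) b) c (gl_br _ _)) ?gr_id ?gl_gr_br //.
rewrite (brE b (a (+) c) _ (gl_br _ _)) ?gr_id ?gl_gr_br // !gl_br_homog.
rewrite !(mulmxBl, mulmxBr) -!scalemxAl -!scalemxAr !mulmxA.
set A := gl_gr a X; set B := gl_gr b Y; set C := gl_gr c Z.
set t1 := A *m B *m C; set t2 := A *m C *m B; set t3 := B *m C *m A.
set t4 := C *m B *m A; set t5 := B *m A *m C; set t6 := C *m A *m B.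
apply/matrixP=> i j; rewrite !mxE.
case: a b c @A @B @C @t1 @t2 @t3 @t4 @t5 @t6 => [] [] [] /= *.
all: rewrite ?expr0 ?expr1; ring.
Qed.

Definition gl : lieSuper F :=
  @LieSuper F 'M[F]_(m + n) gl_gr gl_br gl_grD gl_gr_gr gl_br_linearr
    gl_br_linearl gl_gr_br gl_br_anti gl_br_jacobi.

End GeneralLinear.

Arguments gl_gr {F m n} b.

Section NilpotentSubalgebra.
Variables (F : numFieldType) (m n : nat).

Definition n_space : {vspace gl F m n} :=
  (\sum_(i < m) \sum_(j < m | (i < j)%N)
      <[delta_mx (lshift n i) (lshift n j) : 'M[F]_(m + n)]>
   + \sum_(i < n) \sum_(j < n | (i < j)%N)
      <[delta_mx (rshift m i) (rshift m j) : 'M[F]_(m + n)]>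
   + \sum_(i < m) \sum_(j < n | (i < j)%N)
      <[delta_mx (lshift n i) (rshift m j) : 'M[F]_(m + n)]>
   + \sum_(i < n) \sum_(j < m | (i < j)%N)
      <[delta_mx (rshift m i) (lshift n j) : 'M[F]_(m + n)]>)%VS.

Definition level (k : 'I_(m + n)) : nat :=
  match split k with inl i => i | inr j => j end.

Lemma level_lshift i : level (lshift n i) = i.
Proof. by rewrite /level (unsplitK (inl i)). Qed.

Lemma level_rshift j : level (rshift m j) = j.
Proof. by rewrite /level (unsplitK (inr j)). Qed.

Lemma n_spaceP (X : 'M[F]_(m + n)) :
  X \in n_space <-> forall a b, X a b != 0 -> (level a < level b)%N.
Proof.
pose P (Y : 'M[F]_(m + n)) := forall a b, Y a b != 0 -> (level a < level b)%N.
have PS := @vspace_ofP F 'M[F]_(m + n) P.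
have {}PS : forall v, v \in vspace_of P <-> P v.
  apply: PS => [a b|c X1 X2 P1 P2 a b]; first by rewrite mxE eqxx.
  rewrite !mxE; have [->|/P1 //] := eqVneq (X1 a b) 0.
  by rewrite mulr0 add0r => /P2.
have Pdelta a b : (level a < level b)%N -> delta_mx a b \in vspace_of P.
  move=> ab; apply/PS => c d; rewrite mxE.
  by case: andP => [[/eqP -> /eqP ->]|]; rewrite ?eqxx.
split=> [|PX].
  move=> Xn; apply/PS; move: Xn; apply/subvP; rewrite /n_space !subv_add.
  do ![apply/andP; split]; apply/subv_sumP => i _; apply/subv_sumP => j ij;
  by rewrite -memvE Pdelta ?level_lshift ?level_rshift.
rewrite [X]matrix_sum_delta; apply: memv_suml => a _; apply: memv_suml => b _.
have [->|Xab] := eqVneq (X a b) 0; first by rewrite scale0r mem0v.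
apply: memvZ; move: {Xab} (PX _ _ Xab); rewrite memvE /n_space.
case: (split_ordP a) => i ->; case: (split_ordP b) => j ->;
  rewrite ?level_lshift ?level_rshift => ij.
- do 3![apply: subv_trans (addvSl _ _)].
  by apply: (sumv_sup i) => //; apply: (sumv_sup j).
- do 1![apply: subv_trans (addvSl _ _)]; apply: subv_trans (addvSr _ _).
  by apply: (sumv_sup i) => //; apply: (sumv_sup j).
- apply: subv_trans (addvSr _ _).
  by apply: (sumv_sup i) => //; apply: (sumv_sup j).
- do 2![apply: subv_trans (addvSl _ _)]; apply: subv_trans (addvSr _ _).
  by apply: (sumv_sup i) => //; apply: (sumv_sup j).
Qed.

Lemma n_space_gr b (X : gl F m n) : X \in n_space -> gr b X \in n_space.
Proof.
move=> /n_spaceP nX; apply/n_spaceP => i j; rewrite gl_grE.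
by case: ifP => [_ /nX|]; rewrite ?eqxx.
Qed.

Lemma n_space_mul (X Y : 'M[F]_(m + n)) :
  X \in n_space -> Y \in n_space -> X *m Y \in n_space.
Proof.
move=> /n_spaceP nX /n_spaceP nY; apply/n_spaceP => i j; rewrite mxE.
apply: contraNT; rewrite -leqNgt => ji; apply/eqP; apply: big1 => k _.
have [->|/nX ik] := eqVneq (X i k) 0; first by rewrite mul0r.
have [->|/nY kj] := eqVneq (Y k j) 0; first by rewrite mulr0.
by have := leq_trans (ltn_trans ik kj) ji; rewrite ltnn.
Qed.

Lemma n_space_br (X Y : gl F m n) :
  X \in n_space -> Y \in n_space -> br X Y \in n_space.
Proof.
move=> nX nY; apply: memv_suml => a _; apply: memv_suml => b _.
have nXa : gl_gr a X \in n_space by apply: n_space_gr.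
have nYb : gl_gr b Y \in n_space by apply: n_space_gr.
by apply: memvB; [|apply: memvZ]; apply: n_space_mul.
Qed.

Definition n_alg : lieSuper F := sub_lieSuper n_space_gr n_space_br.

(* The adjoint action on n of the diagonal matrix with entries h. *)
Definition diag_ad (h : 'rV[F]_(m + n)) : 'End(n_alg) :=
  linfun (fun x => vsproj n_space (br (diag_mx h : gl F m n) (vsval x))).

Lemma val_diag_ad h (x : n_alg) :
  vsval (diag_ad h x) = diag_mx h *m vsval x - vsval x *m diag_mx h.
Proof.
have brE (X : gl F m n) : br (diag_mx h : gl F m n) X =
    diag_mx h *m X - X *m diag_mx h.
  have gr_h : gl_gr false (diag_mx h) = diag_mx h :> 'M_(m + n).
    apply/matrixP=> i j; rewrite gl_grE !mxE.
    by have [->|] := eqVneq i j; rewrite ?addbb // mulr0n if_same.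
  rewrite -[in LHS](gl_grD X) -[gl_gr false X]scale1r br_linearr scale1r.
  rewrite /= -gr_h !gl_br_homog gr_h !scale1r addrACA -opprD -mulmxDr -mulmxDl.
  by rewrite gl_grD.
rewrite linfunE => [|a y z].
  rewrite vsprojK brE //; have /n_spaceP nx := subvsP x.
  apply/n_spaceP => i j; rewrite mul_diag_mx mul_mx_diag !mxE => ne.
  by apply: nx; apply: contraNneq ne => ->; rewrite mulr0 mul0r subr0.
by rewrite linearP br_linearr linearP.
Qed.

(* The weights, with 1-based indices: eps k (1 <= k <= m) and delta k
   (1 <= k <= n) are the k-th even and odd diagonal entries. *)
Definition eps (k : nat) : 'Hom('rV[F]_(m + n), F^o) :=
  linfun (fun h : 'rV[F]_(m + n) =>
    \sum_(i < m | i.+1 == k) h 0 (lshift n i) : F^o).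

Definition delta (k : nat) : 'Hom('rV[F]_(m + n), F^o) :=
  linfun (fun h : 'rV[F]_(m + n) =>
    \sum_(j < n | j.+1 == k) h 0 (rshift m j) : F^o).

Lemma epsE (i : 'I_m) h : eps i.+1 h = h 0 (lshift n i).
Proof.
rewrite linfunE => [|a x y]; last first.
  by rewrite scaler_sumr -big_split; apply: eq_bigr => j _; rewrite !mxE.
by rewrite (big_pred1 i) // => j; rewrite eqSS.
Qed.

Lemma deltaE (j : 'I_n) h : delta j.+1 h = h 0 (rshift m j).
Proof.
rewrite linfunE => [|a x y]; last first.
  by rewrite scaler_sumr -big_split; apply: eq_bigr => i _; rewrite !mxE.
by rewrite (big_pred1 j) // => i; rewrite eqSS.
Qed.

Definition H1 : {vspace quotv (coboundaries n_alg 1)} := cohomology n_alg 1.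
Definition H1_of_parity (b : bool) : {vspace quotv (coboundaries n_alg 1)} :=
  cohomology_of_parity n_alg 1 b.
Definition H1_weight (mu : 'Hom('rV[F]_(m + n), F^o)) :
    {vspace quotv (coboundaries n_alg 1)} := cohomology_weight diag_ad 1 mu.

(* U is the direct sum of one-dimensional weight spaces, with weights ws. *)
Definition sum_of_weight_lines (U : {vspace quotv (coboundaries n_alg 1)})
    (ws : seq 'Hom('rV[F]_(m + n), F^o)) : Prop :=
  [/\ U = (\sum_(mu <- ws) (U :&: H1_weight mu))%VS,
      directv (\sum_(mu <- ws) (U :&: H1_weight mu))
    & forall mu, \dim (U :&: H1_weight mu) = (mu \in ws)].

End NilpotentSubalgebra.

(* Main.v *)
Require Import Defs.
From mathcomp Require Import all_boot all_order all_algebra.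
From mathcomp Require Import reals complex zify.

Set Implicit Arguments.
Unset Strict Implicit.
Unset Printing Implicit Defensive.

Import Order.TTheory GRing.Theory Num.Theory.
Local Open Scope ring_scope.

(** Coboundaries vanish in degree 1, so H^1 is the space of linear forms on n
    that kill [n, n].  Put E_ab at height level b - level a >= 1.  Brackets have
    height at least 2; conversely, since n <= m, every intermediate level is
    attained by an even index c, and [E_ac, E_cb] = E_ab then shows that
    [n, n] contains all E_ab of height at least 2.  Hence the coordinate forms
    of the E_ab of height 1 are a basis of H^1, and their weights are pairwise
    distinct because the characteristic is not 2. *)

(** * Cochains, cocycles and weights in degree one, for an arbitrary Lie superalgebra *)

Section DegreeOne.
Variables (F : numFieldType) (G : lieSuper F).

(** On a single homogeneous argument the sum over [i < j] that defines the differential is empty. *)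
Lemma coboundaries1 : coboundaries G 1 = 0%VS.
Proof.
apply/eqP; rewrite -subv0; apply/subvP => _ /memv_imgP[f _ ->].
rewrite memv0; apply/eqP/mform_eqP => -[|x []] // _.
have d_homog a : ce_diff G 0 f (gr a x) = 0.
  rewrite -[LHS]/(meval (ce_diff G 0 f) [:: gr a x]).
  rewrite (@meval_ce_diff _ _ _ _ [:: a]) //; last first.
    by split=> //=; rewrite gr_gr eqxx.
  by rewrite big_ord1 big_ord0.
by rewrite /= -[x]grD linearD /= !d_homog zero_lfunE addr0.
Qed.

Lemma quo_coboundaries1_inj : injective (quo (coboundaries G 1)).
Proof. by apply/lker0P; rewrite lker_quo coboundaries1. Qed.

(** The symmetry relations involve two arguments, so none of them constrains a linear form. *)
Lemma cochains1 (f : mform G 1) : f \in cochains G 1.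
Proof. by apply/cochainsP => w1 w2 a b x y. Qed.

(** On homogeneous arguments the differential of [f] is [f (br x y)] up to sign; splitting [x] and
    [y] into components extends this to all arguments. *)
Lemma cocycles1P (f : mform G 1) :
  f \in cocycles G 1 <-> forall x y, f (br x y) = 0.
Proof.
have dE a b x y : exists k,
    ce_diff G 1 f (gr a x) (gr b y) = (-1) ^+ k * f (br (gr a x) (gr b y)).
  exists (ce_sigma [:: a; b] 0 1).
  rewrite -[LHS]/(meval (ce_diff G 1 f) [:: gr a x; gr b y]).
  rewrite (@meval_ce_diff _ _ _ _ [:: a; b]) //; last first.
    by split=> //=; rewrite !gr_gr !eqxx.
  by rewrite big_ord_recl big_ord0 big_ord1 big_ord1 add0r.
have brDr x y z : br x (y + z) = br x y + br x z :> G.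
  by have := br_linearr x 1 y z; rewrite !scale1r.
have brDl x y z : br (y + z) x = br y x + br z x :> G.
  by have := br_linearl x 1 y z; rewrite !scale1r.
rewrite memv_cap cochains1 memv_ker /=; split=> [/eqP df0 x y|f0].
  suff f0 a b : f (br (gr a x) (gr b y)) = 0.
    by rewrite -[x]grD -[y]grD !(brDl, brDr, linearD) /= !f0 !addr0.
  have [k /esym/eqP] := dE a b x y.
  by rewrite df0 !zero_lfunE mulf_eq0 signr_eq0 => /eqP.
apply/eqP; apply: (@mform_eqP _ _ 2) => -[|x [|y []]] // _ /=.
have d0 a b : ce_diff G 1 f (gr a x) (gr b y) = 0.
  by have [k ->] := dE a b x y; rewrite f0 mulr0.
rewrite -[x]grD -[y]grD !linearD /= !add_lfunE !d0 !addr0.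
by rewrite !zero_lfunE !addr0.
Qed.

Lemma cochains_of_parity1P b (f : mform G 1) :
  f \in cochains_of_parity G 1 b <-> forall x, f (gr (~~ b) x) = 0.
Proof.
split=> [/cochains_of_parityP[_ fb] x|fb].
  apply: (fb [:: ~~ b] [:: gr (~~ b) x]) => //; last by case: b {fb}.
  by split=> //=; rewrite gr_gr eqxx.
apply/cochains_of_parityP; split; first exact: cochains1.
move=> [|a [|? ?]] [|x []] // _ [] // [<- _] /=.
by rewrite addn0 oddb; case: a b fb => -[].
Qed.

Lemma form_act1 (D : 'End(G)) (f : mform G 1) x : form_act D f x = - f (D x).
Proof.
rewrite -[LHS]/(meval (form_act D f) [:: x]) form_actP //.
by rewrite big_ord1.
Qed.

(** As there are no nonzero coboundaries, a class has a single representing cocycle, and the weight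
    condition on the class already holds for that form. *)
Lemma cohomology_weight1P (T : vectType F) (D : T -> 'End(G))
    (mu : 'Hom(T, F^o)) (f : mform G 1) :
  quo (coboundaries G 1) f \in cohomology_weight D 1 mu <->
  f \in cocycles G 1 /\ forall h, form_act (D h) f = mu h *: f.
Proof.
split=> [/cohomology_weightP[g [Zg /quo_coboundaries1_inj -> muf]]|[Zf muf]].
  by split=> // h; apply: quo_coboundaries1_inj; rewrite linearZ /= muf.
by apply/cohomology_weightP; exists f; split=> // h; rewrite muf linearZ.
Qed.

End DegreeOne.

(** * Matrix units of n and their coordinate forms *)

Section FirstCohomology.
Variables (F : numFieldType) (m n : nat).
Local Notation idx := 'I_(m + n).
Local Notation L := (n_alg F m n).
Local Notation quo1 := (quo (coboundaries L 1)).
Implicit Types p q : idx * idx.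

(** Meant for [level p.1 < level p.2], where the matrix unit lies in n; for other pairs [vsproj]
    returns an irrelevant vector. *)
Definition nbasis p : L := vsproj (n_space F m n) (delta_mx p.1 p.2).

(** The inclusion of n into the matrices, sealed against simplification so that the rewriting rules
    below keep applying. *)
Definition nmat (x : L) : 'M[F]_(m + n) := vsval x.
Arguments nmat : simpl never.

Definition ncoord p : mform L 1 := linfun (fun x : L => nmat x p.1 p.2 : F^o).

Definition adjacent p := level p.2 == (level p.1).+1.

Lemma nmat_inj : injective nmat.
Proof. exact: subvs_inj. Qed.

Lemma nmatP a x y : nmat (a *: x + y) = a *: nmat x + nmat y.
Proof. by []. Qed.

Lemma nmatZ a x : nmat (a *: x) = a *: nmat x.
Proof. by []. Qed.

Lemma nmat_sum I (r : seq I) (f : I -> L) :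
  nmat (\sum_(i <- r) f i) = \sum_(i <- r) nmat (f i).
Proof. exact: linear_sum. Qed.

Lemma nmat_n_space x : nmat x \in n_space F m n.
Proof. exact: subvsP. Qed.

Lemma nmat_br x y : nmat (br x y) = gl_br (nmat x) (nmat y).
Proof. exact: (val_sub_br (@n_space_br F m n)). Qed.

Lemma nmat_gr b x : nmat (gr b x) = gl_gr b (nmat x).
Proof. exact: (val_sub_gr (@n_space_gr F m n)). Qed.

Lemma nmat_diag_ad h x :
  nmat (diag_ad h x) = diag_mx h *m nmat x - nmat x *m diag_mx h.
Proof. exact: val_diag_ad. Qed.

Lemma ncoordE p (x : L) : ncoord p x = nmat x p.1 p.2.
Proof. by rewrite linfunE // => a y z; rewrite nmatP !mxE. Qed.

Lemma n_alg_strict (x : L) a b : nmat x a b != 0 -> (level a < level b)%N.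
Proof. by have /n_spaceP := nmat_n_space x; apply. Qed.

Lemma nmat_nbasis p : (level p.1 < level p.2)%N ->
  nmat (nbasis p) = delta_mx p.1 p.2.
Proof.
move=> lt_p; rewrite /nmat vsprojK //; apply/n_spaceP => a b; rewrite mxE.
by case: andP => [[/eqP -> /eqP ->]|]; rewrite ?eqxx.
Qed.

Lemma adjacent_lt p : adjacent p -> (level p.1 < level p.2)%N.
Proof. by move/eqP->. Qed.

Lemma ncoord_nbasis p q : (level q.1 < level q.2)%N ->
  ncoord p (nbasis q) = (p == q)%:R.
Proof.
move=> lt_q; rewrite ncoordE nmat_nbasis // mxE.
by case: p q {lt_q} => a b [c d].
Qed.

(** The sum may run over all pairs: where [nbasis] is meaningless, the entry of [x] is zero. *)
Lemma nbasis_sum (x : L) : x = \sum_p nmat x p.1 p.2 *: nbasis p.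
Proof.
apply: nmat_inj; rewrite nmat_sum [LHS]matrix_sum_delta pair_bigA /=.
apply: eq_bigr => p _; rewrite nmatZ.
have [->|/n_alg_strict lt_p] := eqVneq (nmat x p.1 p.2) 0.
  by rewrite !scale0r.
by rewrite nmat_nbasis.
Qed.

(** * Brackets of matrix units, and the linear forms that vanish on all brackets *)

Lemma gl_br_homogE (A B : 'M[F]_(m + n)) a b :
  gl_gr a A = A -> gl_gr b B = B ->
  gl_br A B = A *m B - (-1) ^+ (a && b) *: (B *m A).
Proof. by move=> /= <- <-; rewrite gl_br_homog. Qed.

Lemma gl_gr_delta (a b : idx) :
  gl_gr (idx_odd a (+) idx_odd b) (delta_mx a b) = delta_mx a b :> 'M[F]_(m + n).
Proof.
apply/matrixP => i j; rewrite gl_grE mxE.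
have [->|] := eqVneq i a; last by rewrite if_same.
have [->|] := eqVneq j b; last by rewrite if_same.
by rewrite eqxx.
Qed.

(** The other product [E_cb E_ac] vanishes because [a] and [b] differ, so the sign in the
    superbracket has no effect. *)
Lemma nbasis_br (a b c : idx) : (level a < level c)%N -> (level c < level b)%N ->
  nbasis (a, b) = br (nbasis (a, c)) (nbasis (c, b)).
Proof.
move=> ac cb; have ab := ltn_trans ac cb.
apply: nmat_inj; rewrite nmat_br !nmat_nbasis //=.
rewrite (gl_br_homogE (gl_gr_delta a c) (gl_gr_delta c b)).
rewrite mul_delta_mx mul_delta_mx_0 ?scaler0 ?subr0 //.
by apply: contraTneq ab => ->; rewrite ltnn.
Qed.

(** Each factor raises the level by at least one, so a product has entries only at height two or
    more. *)
Lemma n_space_mul_adjacent (A B : 'M[F]_(m + n)) p :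
  A \in n_space F m n -> B \in n_space F m n -> adjacent p ->
  (A *m B) p.1 p.2 = 0.
Proof.
move=> /n_spaceP nA /n_spaceP nB /eqP adj; rewrite mxE big1 // => c _.
have [->|/nA ac] := eqVneq (A p.1 c) 0; first by rewrite mul0r.
have [->|/nB cb] := eqVneq (B c p.2) 0; first by rewrite mulr0.
by have := leq_ltn_trans ac cb; rewrite adj ltnn.
Qed.

Lemma ncoord_cocycle p : adjacent p -> ncoord p \in cocycles L 1.
Proof.
move=> adj; apply/cocycles1P => x y; rewrite ncoordE nmat_br.
rewrite summxE big1 // => a _; rewrite summxE big1 // => b _.
have nx : gl_gr a (nmat x) \in n_space F m n by apply/n_space_gr/nmat_n_space.
have ny : gl_gr b (nmat y) \in n_space F m n by apply/n_space_gr/nmat_n_space.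
rewrite mxE n_space_mul_adjacent // mxE mxE n_space_mul_adjacent //.
by rewrite mulr0 subr0.
Qed.

(** [E_p] is a bracket through the even index one level above [p.1], and cocycles kill brackets. *)
Lemma cocycle_nbasis f p : (n <= m)%N -> f \in cocycles L 1 ->
  (level p.1 < level p.2)%N -> ~~ adjacent p -> f (nbasis p) = 0.
Proof.
move=> le_nm /cocycles1P Zf lt_p nadj.
have lt2 : ((level p.1).+1 < level p.2)%N.
  by rewrite ltn_neqAle lt_p andbT eq_sym.
(* That even index exists: the level of [p.2] is below [m] even for odd [p.2], because [n <= m]. *)
have lt_m : ((level p.1).+1 < m)%N.
  apply: leq_trans lt2 (ltnW _).
  by rewrite /level; case: split => i //; apply: leq_trans le_nm.
case: p lt2 lt_m {lt_p nadj} => a b /= lt2 lt_m.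
by rewrite (@nbasis_br a b (lshift n (Ordinal lt_m))) ?level_lshift.
Qed.

Lemma cocycle_sum f : (n <= m)%N -> f \in cocycles L 1 ->
  f = \sum_(p | adjacent p) f (nbasis p) *: ncoord p.
Proof.
move=> le_nm Zf; apply/lfunP => x; rewrite {1}[x]nbasis_sum linear_sum /=.
rewrite sum_lfunE [RHS]big_mkcond /=; apply: eq_bigr => p _; rewrite linearZ /=.
case: ifP => [_|/negbT nadj]; first by rewrite scale_lfunE ncoordE [RHS]mulrC.
(* For a non-adjacent pair, either the entry of [x] is zero or the level strictly increases and
   [cocycle_nbasis] applies. *)
have [->|/n_alg_strict lt_p] := eqVneq (nmat x p.1 p.2) 0.
  by rewrite scale0r.
by rewrite cocycle_nbasis // scaler0.
Qed.

(** This turns spans into vanishing conditions on matrix units, from which freeness, parity and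
    weights are read off. In the converse direction, the expansion [cocycle_sum] loses its terms
    outside [ps]. *)
Lemma span_ncoordP (ps : seq (idx * idx)) f : (n <= m)%N -> all adjacent ps ->
  f \in <<map ncoord ps>>%VS <->
  f \in cocycles L 1 /\
  forall p, adjacent p -> p \notin ps -> f (nbasis p) = 0.
Proof.
move=> le_nm /allP adj; split=> [f_ps|[Zf f0]]; last first.
  rewrite (cocycle_sum le_nm Zf); apply: memv_suml => p adj_p.
  have [p_ps|/(f0 p adj_p) ->] := boolP (p \in ps).
    by apply/memvZ/memv_span/map_f.
  by rewrite scale0r mem0v.
split=> [|p adj_p p_ps].
  move: f f_ps; apply/subvP/span_subvP => _ /mapP[p /adj adj_p ->].
  exact: ncoord_cocycle.
(* Evaluation is made a linear map, so that vanishing becomes membership in its kernel and can be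
   tested on generators. *)
pose ev := linfun (fun g : mform L 1 => g (nbasis p)).
have evE g : ev g = g (nbasis p).
  by rewrite linfunE // => a u v; rewrite add_lfunE scale_lfunE.
rewrite -evE; apply/eqP; rewrite -memv_ker; move: f f_ps.
apply/subvP/span_subvP => _ /mapP[q q_ps ->].
rewrite memv_ker evE ncoord_nbasis ?adjacent_lt //.
by case: (eqVneq q p) p_ps => [<-|//]; rewrite q_ps.
Qed.

(** If [ncoord p] were in the span of the forms after it, it would vanish on [nbasis p], where its
    value is 1. *)
Lemma free_ncoord (ps : seq (idx * idx)) : (n <= m)%N -> uniq ps ->
  all adjacent ps -> free (map ncoord ps).
Proof.
move=> le_nm; elim: ps => [|p ps IH] /= => [_ _|/andP[p_ps ups] /andP[adj_p adj]].
  exact: nil_free.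
rewrite free_cons IH // andbT; apply/negP => /span_ncoordP[] // _.
move=> /(_ p adj_p p_ps) /eqP; rewrite ncoord_nbasis ?adjacent_lt // eqxx.
by rewrite oner_eq0.
Qed.

Lemma cocycles_span (ps : seq (idx * idx)) : (n <= m)%N ->
  ps =i [pred p | adjacent p] -> cocycles L 1 = <<map ncoord ps>>%VS.
Proof.
move=> le_nm psE; apply/vspaceP => f.
have adj : all adjacent ps by apply/allP => p; rewrite psE.
apply/idP/idP => [Zf|/span_ncoordP[]//].
by apply/span_ncoordP => //; split=> // p; rewrite psE inE => ->.
Qed.

(** * Parity of the coordinate forms *)

Lemma gr_nbasis p b : (level p.1 < level p.2)%N ->
  gr b (nbasis p) = if idx_odd p.1 (+) idx_odd p.2 == b then nbasis p else 0.
Proof.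
move=> lt_p; apply: nmat_inj; rewrite nmat_gr /=.
(* The matrix unit is written as its own homogeneous component, so that [gl_gr_gr] decides which
   projections kill it. *)
rewrite nmat_nbasis // -gl_gr_delta gl_gr_gr eq_sym gl_gr_delta.
by case: eqP; rewrite ?nmat_nbasis.
Qed.

Lemma ncoord_parity p :
  ncoord p \in cochains_of_parity L 1 (idx_odd p.1 (+) idx_odd p.2).
Proof.
apply/cochains_of_parity1P => x; rewrite ncoordE nmat_gr gl_grE.
by case: (_ (+) _).
Qed.

(** A form of parity [b] kills the matrix units of the other parity, so only pairs of parity [b]
    survive in the expansion of such a cocycle. *)
Lemma cocycles_of_parity_span (ps : seq (idx * idx)) b : (n <= m)%N ->
  ps =i [pred p | adjacent p & idx_odd p.1 (+) idx_odd p.2 == b] ->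
  (cochains_of_parity L 1 b :&: cocycles L 1)%VS = <<map ncoord ps>>%VS.
Proof.
move=> le_nm psE; apply/vspaceP => f; rewrite memv_cap.
have adj : all adjacent ps by apply/allP => p; rewrite psE inE => /andP[].
apply/andP/idP => [[/cochains_of_parity1P fb Zf]|f_ps].
  apply/span_ncoordP => //; split=> // p adj_p.
  rewrite psE inE adj_p /= => np; rewrite -(fb (nbasis p)) gr_nbasis.
    by rewrite ifT //; move: np; case: (_ (+) _) b {psE fb} => -[].
  exact: adjacent_lt.
split; last by have [] := (span_ncoordP f le_nm adj).1 f_ps.
move: f f_ps; apply/subvP/span_subvP => _ /mapP[p p_ps ->].
by move: p_ps; rewrite psE inE => /andP[_ /eqP <-]; apply: ncoord_parity.
Qed.

(** * Weights under the diagonal matrices *)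

Definition pair_weight p : 'Hom('rV[F]_(m + n), F^o) :=
  linfun (fun h : 'rV[F]_(m + n) => h 0 p.2 - h 0 p.1 : F^o).

Lemma pair_weightE p h : pair_weight p h = h 0 p.2 - h 0 p.1.
Proof.
rewrite linfunE // => a x y; rewrite !mxE scalerBr opprD.
by rewrite addrACA.
Qed.

(** For [p = (a, b)] and [q = (c, d)], the unit row at [b] gives [1 = [d = b] - [c = b]]. This
    forces [d = b], since in characteristic zero [1] differs from [0] and [-1]; the unit row at [a]
    then gives [c = a]. *)
Lemma pair_weight_inj p q : adjacent p -> adjacent q ->
  pair_weight p = pair_weight q -> p = q.
Proof.
case: p q => [a b] [c d] adj_p adj_q eq_w.
have ab : a != b by apply: contraTneq adj_p => ->; rewrite /adjacent ltn_eqF.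
have cd : c != d by apply: contraTneq adj_q => ->; rewrite /adjacent ltn_eqF.
have eq_delta k : (b == k)%:R - (a == k)%:R = (d == k)%:R - (c == k)%:R :> F.
  move/lfunP/(_ (delta_mx 0 k)): eq_w.
  by rewrite !pair_weightE !mxE eqxx.
have N1 : (1 : F) != - 1 by rewrite -addr_eq0 -(natrD _ 1 1) pnatr_eq0.
have e1 := eq_delta b; have e2 := eq_delta a; move: e1 e2.
rewrite !eqxx (negbTE ab) (eq_sym b) (negbTE ab) subr0 sub0r.
case: (eqVneq d b) => [->|_].
  move=> _; rewrite (eq_sym b) (negbTE ab) sub0r => /oppr_inj.
  by case: eqVneq => [->|_ /eqP]; rewrite ?oner_eq0.
case: eqP => _ /eqP; rewrite sub0r ?oppr0 ?oner_eq0 //.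
by rewrite (negbTE N1).
Qed.

(** The matrix unit is an eigenvector of the adjoint action with eigenvalue [h 0 p.1 - h 0 p.2]; the
    dual action changes the sign. As [f] is arbitrary, any nonzero value [f (nbasis p)] detects the
    weight of [f]. *)
Lemma form_act_nbasis (f : mform L 1) p h : (level p.1 < level p.2)%N ->
  form_act (diag_ad h) f (nbasis p) = pair_weight p h * f (nbasis p).
Proof.
move=> lt_p; rewrite form_act1 pair_weightE.
suff -> : diag_ad h (nbasis p) = (h 0 p.1 - h 0 p.2) *: nbasis p.
  by rewrite linearZ /= -mulNr opprB.
apply: nmat_inj; rewrite nmat_diag_ad nmatZ nmat_nbasis //.
apply/matrixP => i j; rewrite mul_diag_mx mul_mx_diag !mxE.
case: eqVneq => [->|]; last by rewrite /= mulr0 mul0r subr0 mulr0.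
case: eqVneq => [->|]; last by rewrite /= mulr0 mul0r subr0 mulr0.
by rewrite !mulr1 mul1r.
Qed.

Lemma form_act_ncoord p h :
  form_act (diag_ad h) (ncoord p) = pair_weight p h *: ncoord p.
Proof.
apply/lfunP => x; rewrite form_act1 scale_lfunE pair_weightE !ncoordE.
rewrite nmat_diag_ad mul_diag_mx mul_mx_diag !mxE opprB.
by rewrite [h 0 p.1 * _]mulrC -mulrBr mulrC.
Qed.

Lemma span_classes (ps : seq (idx * idx)) :
  <<map (quo1 \o ncoord) ps>>%VS = (quo1 @: <<map ncoord ps>>)%VS.
Proof. by rewrite (map_comp quo1 ncoord) limg_span. Qed.

Lemma span_weight (ps : seq (idx * idx)) mu : (n <= m)%N -> all adjacent ps ->
  (<<map (quo1 \o ncoord) ps>> :&: H1_weight mu)%VS =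
  <<map (quo1 \o ncoord) [seq p <- ps | pair_weight p == mu]>>%VS.
Proof.
move=> le_nm adj; rewrite !span_classes.
apply/vspaceP => c; rewrite memv_cap.
have adj_mu : all adjacent [seq p <- ps | pair_weight p == mu].
  by apply/allP => p; rewrite mem_filter => /andP[_]; apply/allP.
apply/andP/idP => [[/memv_imgP[f f_ps ->] /cohomology_weight1P[Zf muf]]|].
  apply/memv_img/span_ncoordP => //; split=> // p adj_p; rewrite mem_filter.
  rewrite negb_and; have [_ /=|ne _] := eqVneq (pair_weight p) mu.
    by case/span_ncoordP: f_ps => // _; apply.
  (* If [f] were nonzero on [nbasis p], comparing its weight [mu] with [form_act_nbasis] would give
     [pair_weight p = mu]. *)
  apply/eqP; apply: contraNT ne => fp; apply/eqP/lfunP => h.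
  apply: (mulIf fp); rewrite -form_act_nbasis ?adjacent_lt // muf.
  by rewrite scale_lfunE.
move=> c_ps; apply/andP; rewrite -memv_cap; move: c c_ps.
apply/subvP; rewrite limg_span; apply/span_subvP => c.
move=> /mapP[_ /mapP[p p_ps ->] ->]; move: p_ps.
rewrite mem_filter => /andP[/eqP <- p_ps]; rewrite memv_cap memv_img; last first.
  by apply/memv_span/map_f.
apply/cohomology_weight1P; split; last exact: form_act_ncoord.
by apply: ncoord_cocycle; apply: (allP adj).
Qed.

Lemma free_quo_ncoord (ps : seq (idx * idx)) : (n <= m)%N -> uniq ps ->
  all adjacent ps -> free (map (quo1 \o ncoord) ps).
Proof.
move=> le_nm ups adj; rewrite /free span_classes.
rewrite limg_dim_eq; first by rewrite (eqP (free_ncoord le_nm ups adj)) !size_map.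
have /lker0P/eqP -> := @quo_coboundaries1_inj _ L.
by rewrite capv0.
Qed.

(** Since the weights of the pairs are distinct, at most one class of the free family has weight
    [mu], so each intersection is a line or zero. *)
Lemma sum_of_weight_lines_span (ps : seq (idx * idx)) : (n <= m)%N ->
  uniq ps -> all adjacent ps ->
  sum_of_weight_lines <<map (quo1 \o ncoord) ps>>%VS (map pair_weight ps).
Proof.
move=> le_nm ups adj; set U := span _.
have uniq_w : uniq (map pair_weight ps).
  rewrite map_inj_in_uniq // => p q /(allP adj) adj_p /(allP adj) adj_q.
  exact: pair_weight_inj.
have dimU : \dim U = size ps.
  by rewrite (eqP (free_quo_ncoord le_nm ups adj)) size_map.
have dim_w mu : \dim (U :&: H1_weight mu) = (mu \in map pair_weight ps).
  have adj_mu : all adjacent [seq p <- ps | pair_weight p == mu].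
    by apply/allP => p; rewrite mem_filter => /andP[_]; apply/allP.
  rewrite span_weight // (eqP (free_quo_ncoord _ _ _)) ?filter_uniq //.
  by rewrite size_map size_filter -count_uniq_mem // count_map.
have sumU : U = (\sum_(mu <- map pair_weight ps) (U :&: H1_weight mu))%VS.
  apply/eqP; rewrite eqEsubv; apply/andP; split; last first.
    by elim/big_rec: _ => [|mu V _ sV]; rewrite ?sub0v // subv_add capvSl.
  apply/span_subvP => c /mapP[p p_ps ->].
  rewrite (big_rem (pair_weight p)) ?map_f //=.
  apply: (subvP (addvSl _ _)); rewrite span_weight //.
  by apply/memv_span/map_f; rewrite mem_filter eqxx.
split=> //.
(* Directness is a dimension count: there are [size ps] lines, and their sum [U] has that
   dimension. *)
rewrite directvE /= -sumU dimU (eq_bigr _ (fun mu _ => dim_w mu)).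
rewrite big_seq (eq_bigr (fun=> 1%N)) => [|mu ->] //.
by rewrite -big_seq sum1_size size_map.
Qed.

End FirstCohomology.

(** * Enumeration of the adjacent pairs by the parities of their two indices *)

Section IndexPairs.
Variables (m n : nat) (i0 : 'I_(m + n)).
Local Notation idx := 'I_(m + n).

Definition parity_dim (s : bool) : nat := if s then n else m.

(* 1-based, as are [eps] and [delta]; the value is the junk [i0] when [k] is
   out of range. *)
Definition parity_idx (s : bool) (k : nat) : idx :=
  insubd i0 (if s then m + k.-1 else k.-1)%N.

(** The exclusive upper bound encodes both that [k] is a position of parity [s] and that [k.+1] is
    one of parity [t]. *)
Definition parity_range (s t : bool) : seq nat :=
  index_iota 1 (minn (parity_dim s).+1 (parity_dim t)).

Definition parity_pairs (s t : bool) : seq (idx * idx) :=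
  [seq (parity_idx s k, parity_idx t k.+1) | k <- parity_range s t].

Lemma idx_odd_lshift (i : 'I_m) : idx_odd (lshift n i) = false.
Proof. by rewrite /idx_odd (unsplitK (inl i)). Qed.

Lemma idx_odd_rshift (j : 'I_n) : idx_odd (rshift m j) = true.
Proof. by rewrite /idx_odd (unsplitK (inr j)). Qed.

Lemma parity_idx_even (i : 'I_m) : parity_idx false i.+1 = lshift n i.
Proof. by apply: val_inj; rewrite val_insubd /= ltn_addr. Qed.

Lemma parity_idx_odd (j : 'I_n) : parity_idx true j.+1 = rshift m j.
Proof. by apply: val_inj; rewrite val_insubd /= ltn_add2l ltn_ord. Qed.

Lemma parity_idxP s k : (0 < k <= parity_dim s)%N ->
  idx_odd (parity_idx s k) = s /\ level (parity_idx s k) = k.-1.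
Proof.
case: k s => [|k] [] //= lt_k; rewrite -[k]/(nat_of_ord (Ordinal lt_k)).
  by rewrite parity_idx_odd idx_odd_rshift level_rshift.
by rewrite parity_idx_even idx_odd_lshift level_lshift.
Qed.

(** Parity and level determine an index; this makes the lists of pairs complete. *)
Lemma parity_idx_level (a : idx) :
  a = parity_idx (idx_odd a) (level a).+1 /\
  (level a < parity_dim (idx_odd a))%N.
Proof.
case: (split_ordP a) => i ->.
  by rewrite idx_odd_lshift level_lshift parity_idx_even.
by rewrite idx_odd_rshift level_rshift parity_idx_odd.
Qed.

Lemma mem_parity_range s t k :
  (k \in parity_range s t) =
  (0 < k <= parity_dim s)%N && (0 < k.+1 <= parity_dim t)%N.
Proof. by rewrite mem_index_iota leq_min ltnS /= -andbA. Qed.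

Lemma mem_parity_pairs s t p :
  (p \in parity_pairs s t) =
  [&& adjacent p, idx_odd p.1 == s & idx_odd p.2 == t].
Proof.
apply/mapP/and3P => [[k]|].
  rewrite mem_parity_range => /andP[/[dup] /andP[k0 _] ks kt] -> /=.
  have [-> ls] := parity_idxP ks; have [-> lt] := parity_idxP kt.
  by split=> //; rewrite /adjacent /= ls lt prednK.
case: p => a b /= [/eqP /= adj /eqP sa /eqP tb].
have [ea la] := parity_idx_level a; have [eb lb] := parity_idx_level b.
exists (level a).+1; rewrite ?mem_parity_range; rewrite sa tb adj in ea la eb lb.
  by rewrite /= la lb.
by rewrite -ea -eb.
Qed.

(** The positive position [k] is recovered from the level [k.-1] of the first index. *)
Lemma uniq_parity_pairs s t : uniq (parity_pairs s t).
Proof.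
rewrite map_inj_in_uniq ?iota_uniq // => k l.
rewrite !mem_parity_range => /andP[ks _] /andP[ls _] [] /(congr1 (@level m n)).
have [_ ->] := parity_idxP ks; have [_ ->] := parity_idxP ls.
by move/(congr1 S); rewrite !prednK; [|case/andP: ls|case/andP: ks].
Qed.

Definition parity_coord (F : numFieldType) (s : bool) (k : nat) :
    'Hom('rV[F]_(m + n), F^o) :=
  if s then delta F m n k else eps F m n k.

Lemma parity_coordE F s k h : (0 < k <= parity_dim s)%N ->
  parity_coord F s k h = h 0 (parity_idx s k).
Proof.
case: k s => [|k] [] //= lt_k; rewrite -[k]/(nat_of_ord (Ordinal lt_k)).
  by rewrite deltaE parity_idx_odd.
by rewrite epsE parity_idx_even.
Qed.

Lemma pair_weight_parity_pairs F s t :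
  map (@pair_weight F m n) (parity_pairs s t) =
  [seq parity_coord F t k.+1 - parity_coord F s k | k <- parity_range s t].
Proof.
rewrite -map_comp; apply/eq_in_map => k.
rewrite mem_parity_range => /andP[ks kt]; apply/lfunP => h.
by rewrite /= pair_weightE add_lfunE opp_lfunE !parity_coordE.
Qed.

(** A common member would have the parities of both lists. *)
Lemma uniq_cat_parity_pairs s t s' t' : (s, t) != (s', t') ->
  uniq (parity_pairs s t ++ parity_pairs s' t').
Proof.
move=> ne; rewrite cat_uniq !uniq_parity_pairs andbT /=.
apply/hasPn => p; rewrite !mem_parity_pairs => /and3P[_ /eqP s1 /eqP t1].
by apply: contra ne => /and3P[_]; rewrite s1 t1 => /eqP -> /eqP ->.
Qed.

End IndexPairs.

(** * Dimension and weights of the first cohomology *)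

Section FirstCohomologyWeights.
Variables (F : numFieldType) (m n : nat).
Local Notation quo1 := (quo (coboundaries (n_alg F m n) 1)).

Definition weights_between (s t : bool) : seq 'Hom('rV[F]_(m + n), F^o) :=
  [seq parity_coord m n F t k.+1 - parity_coord m n F s k
     | k <- parity_range m n s t].

(** This treats [n < m] and [m = n] together: the two cases differ only in the bounds hidden in
    [parity_range]. *)
Lemma H1_weights : (0 < n)%N -> (n <= m)%N ->
  let even_ws := weights_between false false ++ weights_between true true in
  let odd_ws := weights_between false true ++ weights_between true false in
  [/\ \dim (H1 F m n) = size (even_ws ++ odd_ws),
      sum_of_weight_lines (H1 F m n) (even_ws ++ odd_ws),
      sum_of_weight_lines (H1_of_parity F m n false) even_ws
    & sum_of_weight_lines (H1_of_parity F m n true) odd_ws].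
Proof.
move=> n0 le_nm even_ws odd_ws.
(* The default value for [parity_idx]: the first odd index, which exists because [n] is positive. *)
pose i0 : 'I_(m + n) := rshift m (Ordinal n0).
pose even_ps := parity_pairs i0 false false ++ parity_pairs i0 true true.
pose odd_ps := parity_pairs i0 false true ++ parity_pairs i0 true false.
have even_wsE : even_ws = map (@pair_weight F m n) even_ps.
  by rewrite map_cat !pair_weight_parity_pairs.
have odd_wsE : odd_ws = map (@pair_weight F m n) odd_ps.
  by rewrite map_cat !pair_weight_parity_pairs.
have evenE : even_ps =i
    [pred p | adjacent p & idx_odd p.1 (+) idx_odd p.2 == false].
  move=> p; rewrite mem_cat !mem_parity_pairs inE.
  by case: (adjacent p) (idx_odd _) (idx_odd _) => [] [] [].
have oddE : odd_ps =i
    [pred p | adjacent p & idx_odd p.1 (+) idx_odd p.2 == true].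
  move=> p; rewrite mem_cat !mem_parity_pairs inE.
  by case: (adjacent p) (idx_odd _) (idx_odd _) => [] [] [].
have allE : even_ps ++ odd_ps =i [pred p | adjacent p].
  move=> p; rewrite mem_cat evenE oddE !inE.
  by case: (adjacent p) (_ (+) _) => [] [].
have uniq_ps : uniq (even_ps ++ odd_ps).
  rewrite cat_uniq !uniq_cat_parity_pairs // andbT /=.
  apply/hasPn => p; rewrite oddE => /andP[_ /eqP odd_p].
  by rewrite /= evenE inE odd_p andbF.
have adj b ps : ps =i [pred p | adjacent p & idx_odd p.1 (+) idx_odd p.2 == b] ->
    all (@adjacent m n) ps.
  by move=> psE; apply/allP => p; rewrite psE inE => /andP[].
have adj_all : all (@adjacent m n) (even_ps ++ odd_ps).
  by apply/allP => p; rewrite allE.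
have H1E : H1 F m n = <<map (quo1 \o @ncoord F m n) (even_ps ++ odd_ps)>>%VS.
  by rewrite span_classes -cocycles_span.
have H1bE b ps :
    ps =i [pred p | adjacent p & idx_odd p.1 (+) idx_odd p.2 == b] ->
    H1_of_parity F m n b = <<map (quo1 \o @ncoord F m n) ps>>%VS.
  by move=> psE; rewrite span_classes -(cocycles_of_parity_span F le_nm psE).
rewrite even_wsE odd_wsE -map_cat size_map; split.
- by rewrite H1E (eqP (free_quo_ncoord _ _ _ _)) // size_map.
- by rewrite H1E; apply: sum_of_weight_lines_span.
- rewrite (H1bE _ _ evenE); apply: sum_of_weight_lines_span => //.
    exact: uniq_cat_parity_pairs.
  exact: adj evenE.
- rewrite (H1bE _ _ oddE); apply: sum_of_weight_lines_span => //.
    exact: uniq_cat_parity_pairs.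
  exact: adj oddE.
Qed.

End FirstCohomologyWeights.

Theorem mainTheorem5 (R : realType) (m n : nat) :
  (1 <= n)%N -> (n <= m)%N ->
  let eps := eps R[i] m n in
  let delta := delta R[i] m n in
  let H1 := H1 R[i] m n in
  let H1_of_parity := H1_of_parity R[i] m n in
  ((n < m)%N ->
     let even_ws := [seq eps i.+1 - eps i | i <- index_iota 1 m] ++
                    [seq delta j.+1 - delta j | j <- index_iota 1 n] in
     let odd_ws := [seq delta i.+1 - eps i | i <- index_iota 1 n] ++
                   [seq eps j.+1 - delta j | j <- index_iota 1 n.+1] in
     [/\ \dim H1 = (m + 3 * n - 3)%N,
         sum_of_weight_lines H1 (even_ws ++ odd_ws),
         sum_of_weight_lines (H1_of_parity false) even_ws
       & sum_of_weight_lines (H1_of_parity true) odd_ws])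
  /\
  (m = n ->
     let even_ws := [seq eps i.+1 - eps i | i <- index_iota 1 n] ++
                    [seq delta i.+1 - delta i | i <- index_iota 1 n] in
     let odd_ws := [seq delta i.+1 - eps i | i <- index_iota 1 n] ++
                   [seq eps i.+1 - delta i | i <- index_iota 1 n] in
     [/\ \dim H1 = (4 * (n - 1))%N,
         sum_of_weight_lines H1 (even_ws ++ odd_ws),
         sum_of_weight_lines (H1_of_parity false) even_ws
       & sum_of_weight_lines (H1_of_parity true) odd_ws]).
Proof.
move=> n0 le_nm; have := @H1_weights R[i] m n n0 le_nm.
rewrite /weights_between /parity_range /parity_coord /parity_dim !size_cat.
rewrite !size_map !size_iota !(minn_idPr (leqnSn _)) (minn_idPr (leqW le_nm)).
(* Only the range of the weights [eps j.+1 - delta j] still contains a minimum, that of [n.+1] and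
   [m]: it is [n.+1] if [n < m], and [n] if [m = n]. *)
move=> H1w; split=> [lt_nm|eq_mn].
  rewrite (minn_idPl lt_nm) in H1w; split; case: H1w => // -> _ _ _.
  (* Writing [m] and [n] as successors resolves the truncated predecessors in the count
     [(m - 1) + (n - 1) + (n - 1) + n]. *)
  by rewrite !subn1 mulSn; case: n n0 m lt_nm {le_nm} => // n' _ [] // m' _ /=; lia.
move: H1w; rewrite eq_mn (minn_idPr (leqnSn _)) => -[dimH1 H1w even_w odd_w].
by split=> //; rewrite dimH1; lia.
Qed.
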